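(* Let $n\ge 1$ and let $(X_1,Y_1),\ldots,(X_n,Y_n)$ be independent pairs of real-valued random variables (the pairs are independent of each other as $i$ varies; within a pair, $X_i$ and $Y_i$ may be dependent), such that each pair is exchangeable, i.e. $(X_i,Y_i)\stackrel{d}{=}(Y_i,X_i)$ for every $i$. Let $f:\mathbb R^n\to\mathbb R$ be a measurable function, and for $i=0,\ldots,n$ let $$Z_i=f(X_1,\ldots,X_i,Y_{i+1},\ldots,Y_n).$$ Then $$E(Z_n-Z_0)^2\le \sum_{i=1}^n E(Z_i-Z_{i-1})^2 .$$
   Context: $\stackrel{d}{=}$ denotes equality in distribution. By definition $Z_0=f(Y_1,\ldots,Y_n)$ and $Z_n=f(X_1,\ldots,X_n)$. No integrability of $f$ is assumed; the expectations are of nonnegative random variables and take values in $[0,\infty]$. *)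

(* Defs.v *)
(* MathComp-Analysis *)
From HB Require Import structures.
From mathcomp Require Import all_boot all_order all_algebra.
From mathcomp Require Import all_classical all_reals all_analysis.
Set Implicit Arguments.
Unset Strict Implicit.
Unset Printing Implicit Defensive.
Import Order.TTheory GRing.Theory Num.Theory.
Local Open Scope classical_set_scope.
Local Open Scope ring_scope.

Section random_variables.
Context d (T : measurableType d) (R : realType) (P : probability T R).

(* The laws are compared on measurable sets only: the value of a measure of the
   library at a nonmeasurable set is unconstrained. *)
Definition eq_in_distribution d' (T' : measurableType d')
    (U V : {RV P >-> T'}) : Prop :=
  forall A : set T', measurable A -> distribution P U A = distribution P V A.

Definition mutually_independent d' (T' : measurableType d') (I : finType)
    (U : I -> {RV P >-> T'}) : Prop :=
  forall (J : {set I}) (A : I -> set T'),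
    (forall i, i \in J -> measurable (A i)) ->
    P (\bigcap_(i in [set` J]) (U i @^-1` A i)) =
    (\prod_(i in J) P (U i @^-1` A i))%E.

Section pair_RV.
Context d1 d2 (T1 : measurableType d1) (T2 : measurableType d2).
Variables (U : {RV P >-> T1}) (V : {RV P >-> T2}).

Definition pair_fun (w : T) : T1 * T2 := (U w, V w).

Let measurable_pair_fun : measurable_fun [set: T] pair_fun.
Proof. by apply/measurable_fun_pair; exact: measurable_funPT. Qed.

HB.instance Definition _ :=
  isMeasurableFun.Build _ _ _ _ pair_fun measurable_pair_fun.

Definition pair_RV : {RV P >-> (T1 * T2)%type} := pair_fun.

End pair_RV.

Definition exchangeable_pair d' (T' : measurableType d')
    (U V : {RV P >-> T'}) : Prop :=
  eq_in_distribution (pair_RV U V) (pair_RV V U).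

(* f (X_1, ..., X_i, Y_{i+1}, ..., Y_n): coordinates are numbered from 0, so
   those below i are the first i ones. *)
Definition interpolated (n : nat) (f : n.-tuple R -> R)
    (X Y : 'I_n -> {RV P >-> R}) (i : nat) (w : T) : R :=
  f [tuple if (j < i)%N then X j w else Y j w | j < n].

End random_variables.

(* Main.v *)
Require Import Defs.
From HB Require Import structures.
From mathcomp Require Import all_boot all_order all_algebra.
From mathcomp Require Import all_classical all_reals all_analysis.
From mathcomp Require Import measurable_realfun ring.
Import Order.TTheory GRing.Theory Num.Theory.
Local Open Scope classical_set_scope.
Local Open Scope ring_scope.

Set Implicit Arguments.
Unset Strict Implicit.

(** For a set A of coordinates let W_A be f applied to the vector that takes
    X_i for i in A and Y_i elsewhere, so that Z_i = W_{1,...,i}, and let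
    D(A, B) = E (W_A - W_B)^2, a number in [0, +oo].

    Exchangeability within the independent pairs makes the joint law of the
    pairs invariant under swapping X_i and Y_i for all i in a set C
    ([swapped_eq_in_distribution]).  Such a swap turns W_A into W_(A + C),
    where + is symmetric difference, so D(A, B) = D(A + C, B + C)
    ([sqdist_swap]).

    For disjoint A and B, put a = W_0 (the empty set), b = W_A, c = W_B and
    e = W_(A u B).  The four values form a quadrilateral with diagonals a-e
    and b-c, and
      (a-b)^2 + (b-e)^2 + (e-c)^2 + (c-a)^2 - (a-e)^2 - (b-c)^2
        = (a-b-c+e)^2 >= 0.
    After taking expectations, invariance under swaps makes the two diagonals
    equal and the opposite sides pairwise equal; halving the inequality gives
    D(0, A u B) <= D(0, A) + D(A, A u B) ([sqdist_subadditive]).  Adding the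
    coordinates one at a time yields the theorem ([sqdist_telescope]).

    Each inequality is between expectations of nonnegative variables and no
    expectation is ever subtracted, so the argument covers infinite values. *)

(** * Boxes and the sigma-algebra of tuples *)

Section box.
Context d' (T' : measurableType d') (n : nat).

Definition box (A : 'I_n -> set T') : set (n.-tuple T') :=
  \bigcap_(i in [set` [set: 'I_n]%SET]) ((@tnth n T')^~ i @^-1` A i).

Definition measurable_boxes : set (set (n.-tuple T')) :=
  [set B | exists2 A, (forall i, measurable (A i)) & B = box A].

Lemma boxT : box (fun=> setT) = setT.
Proof. by rewrite -subTset => t _ i _. Qed.

Lemma boxI (A B : 'I_n -> set T') :
  box A `&` box B = box (fun i => A i `&` B i).
Proof.
rewrite eqEsubset; split=> [t [tA tB] i iT|t tAB].
  by split; [exact: tA|exact: tB].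
by split=> i iT; have [] := tAB i iT.
Qed.

Lemma measurable_box (A : 'I_n -> set T') :
  (forall i, measurable (A i)) -> measurable (box A).
Proof.
move=> mA; apply: fin_bigcap_measurable => [|i _]; first exact: finite_finset.
by rewrite -[X in measurable X]setTI; exact: measurable_tnth.
Qed.

(** The sigma-algebra of tuples is generated by cylinders, sets constraining one
    coordinate.  Boxes generate it too, and unlike cylinders they are stable
    under intersection, as uniqueness of measures requires. *)
Lemma measurable_tupleE : @measurable _ (n.-tuple T') = <<s measurable_boxes >>.
Proof.
rewrite eqEsubset; split; apply: smallest_sub.
- exact: smallest_sigma_algebra.
- rewrite -bigcup_seq; apply: bigcup_sub => i _ _ [A mA <-].
  apply: sub_sigma_algebra.
  exists (fun j => if j == i then A else setT).
    by move=> j; case: ifP.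
  rewrite setTI eqEsubset; split=> t.
    by move=> tA j _ /=; case: eqP => // ->.
  by move=> /(_ i); rewrite /= inE eqxx; exact.
- exact: sigma_algebra_measurable.
- by move=> _ [A mA ->]; exact: measurable_box.
Qed.

End box.

(** * Equality of laws *)

Section laws.
Context d (T : measurableType d) (R : realType) (P : probability T R).

Lemma eq_in_distribution_boxes d' (T' : measurableType d') n
    (U V : {RV P >-> n.-tuple T'}) :
  (forall A, (forall i, measurable (A i)) ->
    distribution P U (box A) = distribution P V (box A)) ->
  eq_in_distribution U V.
Proof.
(* The cover by sets of finite measure that uniqueness asks for is constant,
   since the laws are probabilities. *)
move=> UV; apply: (measure_unique (@measurable_boxes _ T' n) (fun=> setT)).
- exact: measurable_tupleE.
- move=> _ _ [A mA ->] [B mB ->]; exists (fun i => A i `&` B i).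
    by move=> i; exact: measurableI.
  exact: boxI.
- by move=> _; exists (fun=> setT) => //; rewrite boxT.
- by rewrite bigcup_const.
- by move=> _ [A mA ->]; exact: UV.
- move=> _; apply: le_lt_trans (ltry 1).
  exact: (probability_le1 (distribution P U) measurableT).
Qed.

Lemma eq_in_distribution_integral d' (T' : measurableType d')
    (U V : {RV P >-> T'}) (h : T' -> \bar R) :
  eq_in_distribution U V -> measurable_fun [set: T'] h ->
  (forall t, 0 <= h t)%E ->
  (\int[P]_w h (U w) = \int[P]_w h (V w))%E.
Proof.
move=> UV mh h0.
rewrite -[LHS](ge0_integral_distribution U mh h0).
rewrite -[RHS](ge0_integral_distribution V mh h0).
by apply: eq_measure_integral => A mA _; exact: UV.
Qed.

Section tuple_RV.
Context d' (T' : measurableType d') (n : nat).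
Variable U : 'I_n -> {RV P >-> T'}.

Definition tuple_fun (w : T) : n.-tuple T' := [tuple U i w | i < n].

Let measurable_tuple_fun : measurable_fun [set: T] tuple_fun.
Proof.
apply/measurable_fun_tnthP => i.
rewrite (_ : _ \o _ = U i); first exact: measurable_funPT.
by apply/funext => w; rewrite /= tnth_mktuple.
Qed.

HB.instance Definition _ :=
  isMeasurableFun.Build _ _ _ _ tuple_fun measurable_tuple_fun.

Definition tuple_RV : {RV P >-> n.-tuple T'} := tuple_fun.

Lemma tuple_RV_box (A : 'I_n -> set T') :
  tuple_RV @^-1` box A = \bigcap_(i in [set` [set: 'I_n]%SET]) (U i @^-1` A i).
Proof.
by rewrite eqEsubset; split=> w wA i /(wA i); rewrite /= tnth_mktuple.
Qed.

End tuple_RV.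

(** By independence the probability of a box is the product of the marginal
    probabilities of its sides. *)
Lemma independent_eq_in_distribution d' (T' : measurableType d') n
    (U V : 'I_n -> {RV P >-> T'}) :
  mutually_independent U -> mutually_independent V ->
  (forall i, eq_in_distribution (U i) (V i)) ->
  eq_in_distribution (tuple_RV U) (tuple_RV V).
Proof.
move=> iU iV UV; apply: eq_in_distribution_boxes => A mA.
rewrite /distribution /pushforward !tuple_RV_box iU ?iV//.
by apply: eq_bigr => i _; exact: UV.
Qed.

(** * Swapping the members of some of the pairs *)

Section swap.
Context d' (T' : measurableType d') (n : nat).
Variables X Y : 'I_n -> {RV P >-> T'}.

Definition swapped_pair (C : pred 'I_n) (i : 'I_n) : {RV P >-> (T' * T')%type} :=
  if C i then pair_RV (Y i) (X i) else pair_RV (X i) (Y i).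

(** An event about a swapped pair is an event about the original pair, with the
    preimage of its target set under the swap. *)
Lemma swapped_pair_independent (C : pred 'I_n) :
  mutually_independent (fun i => pair_RV (X i) (Y i)) ->
  mutually_independent (swapped_pair C).
Proof.
move=> iXY J A mA.
pose B i := if C i then unstable.swap @^-1` A i else A i.
have AB i : swapped_pair C i @^-1` A i = pair_RV (X i) (Y i) @^-1` B i.
  by rewrite /swapped_pair /B; case: (C i).
under eq_bigcapr do rewrite AB.
under eq_bigr do rewrite AB.
apply: iXY => i iJ; rewrite /B; case: ifP => _; last exact: mA.
by rewrite -[X in measurable X]setTI; apply: measurable_swap => //; exact: mA.
Qed.

Hypothesis indep : mutually_independent (fun i => pair_RV (X i) (Y i)).
Hypothesis exch : forall i, exchangeable_pair (X i) (Y i).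

Lemma swapped_eq_in_distribution (C : pred 'I_n) :
  eq_in_distribution (tuple_RV (fun i => pair_RV (X i) (Y i)))
                     (tuple_RV (swapped_pair C)).
Proof.
apply: independent_eq_in_distribution => //.
  exact: swapped_pair_independent.
by move=> i A mA; rewrite /swapped_pair; case: ifP => // _; exact: exch.
Qed.

Variable f : n.-tuple T' -> R.
Hypothesis mf : measurable_fun [set: n.-tuple T'] f.

Definition select (A : pred 'I_n) (t : n.-tuple (T' * T')) : n.-tuple T' :=
  [tuple if A i then (tnth t i).1 else (tnth t i).2 | i < n].

Lemma measurable_select A : measurable_fun [set: n.-tuple (T' * T')] (select A).
Proof.
apply/measurable_fun_tnthP => i.
rewrite (_ : _ \o _ = (if A i then fst else snd) \o (@tnth n _)^~ i).
  by apply: measurableT_comp; [case: ifP|exact: measurable_tnth].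
by apply/funext => t; rewrite /= tnth_mktuple; case: ifP.
Qed.

(** [interpolated f X Y i] is convertible to [mixed (fun j => (j < i)%N)]; general
    sets of indices are wanted because swaps do not preserve initial segments. *)
Definition mixed (A : pred 'I_n) (w : T) : R :=
  f [tuple if A i then X i w else Y i w | i < n].

(** Reading the first member of a swapped pair is reading the second member of
    the original one, hence the symmetric difference of A and C. *)
Lemma select_swapped (A C : pred 'I_n) w :
  f (select A (tuple_RV (swapped_pair C) w)) =
  mixed (fun i => A i (+) C i) w.
Proof.
congr f; apply: eq_from_tnth => i; rewrite !tnth_mktuple /swapped_pair.
by case: (A i); case: (C i).
Qed.

Lemma mixedE (A : pred 'I_n) w :
  mixed A w = f (select A (tuple_RV (fun i => pair_RV (X i) (Y i)) w)).
Proof. by congr f; apply: eq_from_tnth => i; rewrite !tnth_mktuple. Qed.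

Lemma measurable_mixed A : measurable_fun [set: T] (mixed A).
Proof.
rewrite (_ : mixed A = f \o select A \o tuple_RV (fun i => pair_RV (X i) (Y i))).
  by apply: measurableT_comp; [apply: measurableT_comp => //;
    exact: measurable_select|exact: measurable_funPT].
by apply/funext => w; rewrite mixedE.
Qed.

(** * Mean square distances between mixed vectors *)

Definition sqdist (A B : pred 'I_n) : \bar R :=
  'E_P[fun w => (mixed A w - mixed B w) ^+ 2].

(** Both sides integrate one nonnegative function of n pairs, against the law of
    the original pairs and against that of the pairs swapped along C. *)
Lemma sqdist_swap (C A B : pred 'I_n) :
  sqdist A B = sqdist (fun i => A i (+) C i) (fun i => B i (+) C i).
Proof.
pose h t : \bar R := ((f (select A t) - f (select B t)) ^+ 2)%:E.
have mh : measurable_fun setT h.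
  apply/measurable_EFinP; apply: measurable_funX; apply: measurable_funB;
    by apply: measurableT_comp => //; exact: measurable_select.
have h0 t : (0 <= h t)%E by rewrite lee_fin sqr_ge0.
have := eq_in_distribution_integral (swapped_eq_in_distribution C) mh h0.
rewrite /sqdist unlock /h.
under eq_integral do rewrite -!mixedE.
by under [RHS]eq_integral do rewrite !select_swapped.
Qed.

Lemma sqdistC A B : sqdist A B = sqdist B A.
Proof. by congr expectation; apply/funext => w; rewrite -sqrrN opprB. Qed.

(** In an inner product space the squared diagonals of a quadrilateral sum to at
    most the sum of the squared sides; the random variables here may fail to be
    square integrable, so the integrated form contains sums only. *)
Lemma sqdist_quadrilateral A B C D :
  (sqdist A D + sqdist B C <=
   sqdist A B + sqdist B D + (sqdist D C + sqdist C A))%E.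
Proof.
have ms E F : measurable_fun setT
    (fun w => ((mixed E w - mixed F w) ^+ 2)%:E : \bar R).
  apply/measurable_EFinP; apply: measurable_funX.
  by apply: measurable_funB; exact: measurable_mixed.
have s0 E F w : (0 <= ((mixed E w - mixed F w) ^+ 2)%:E :> \bar R)%E.
  by rewrite lee_fin sqr_ge0.
rewrite /sqdist unlock.
rewrite -!ge0_integralD//; last 4 first.
- by move=> w _; exact: adde_ge0.
- exact: emeasurable_funD.
- by move=> w _; exact: adde_ge0.
- exact: emeasurable_funD.
apply: ge0_le_integral => //.
- by move=> w _; exact: adde_ge0.
- exact: emeasurable_funD.
- by apply: emeasurable_funD; exact: emeasurable_funD.
move=> w _; rewrite -!EFinD lee_fin -subr_ge0.
set a := mixed A w; set b := mixed B w; set c := mixed C w; set e := mixed D w.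
rewrite (_ : _ - _ = (a - b - c + e) ^+ 2) ?sqr_ge0//.
by ring.
Qed.

(** The four points for the empty set, A, B and their union form a quadrilateral
    whose diagonals have equal length and whose opposite sides have equal
    length, because swapping along A or B exchanges them.  So the inequality
    for quadrilaterals is twice the one below. *)
Lemma sqdist_subadditive (A B : pred 'I_n) : (forall i, ~~ (A i && B i)) ->
  (sqdist xpred0 (predU A B) <= sqdist xpred0 A + sqdist A (predU A B))%E.
Proof.
move=> AB.
have diag : sqdist A B = sqdist xpred0 (predU A B).
  rewrite (sqdist_swap A); congr sqdist; apply/funext => i /=.
    by rewrite addbb.
  by have := AB i; case: (A i); case: (B i).
have sideA : sqdist (predU A B) B = sqdist xpred0 A.
  rewrite (sqdist_swap B) sqdistC; congr sqdist; apply/funext => i /=.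
    by rewrite addbb.
  by have := AB i; case: (A i); case: (B i).
have sideB : sqdist B xpred0 = sqdist A (predU A B).
  rewrite (sqdist_swap A) sqdistC; congr sqdist; apply/funext => i /=.
  by have := AB i; case: (A i); case: (B i).
have := sqdist_quadrilateral xpred0 A B (predU A B).
rewrite diag sideA sideB -!mule2n -!mule_natl.
by rewrite lee_pmul2l.
Qed.

Lemma sqdist_telescope m :
  (sqdist xpred0 (fun j => (j < m)%N) <=
   \sum_(1 <= i < m.+1) sqdist (fun j => (j < i.-1)%N) (fun j => (j < i)%N))%E.
Proof.
elim: m => [|m IH].
  rewrite big_nil /sqdist unlock integral0_eq// => w _.
  by rewrite subrr expr0n.
have ltSE : (fun j : 'I_n => (j < m.+1)%N) =
    predU (fun j : 'I_n => (j < m)%N) (fun j : 'I_n => j == m :> nat).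
  by apply/funext => j /=; rewrite ltnS leq_eqVlt orbC.
rewrite big_nat_recr//= ltSE.
apply: le_trans (sqdist_subadditive _) _; last by rewrite leeD2r.
by move=> j; apply/negP => /andP[+ /eqP jm]; rewrite jm ltnn.
Qed.

End swap.
End laws.

Theorem theorem2 (R : realType) (d : measure_display) (T : measurableType d)
  (P : probability T R) (n : nat) (n_ge1 : (1 <= n)%N)
  (X Y : 'I_n -> {RV P >-> R})
  (indep : mutually_independent (fun i : 'I_n => pair_RV (X i) (Y i)))
  (exch : forall i : 'I_n, exchangeable_pair (X i) (Y i))
  (f : n.-tuple R -> R) (mf : measurable_fun [set: n.-tuple R] f) :
  let Z := interpolated f X Y in
  ('E_P[fun w => ((Z n w - Z 0%N w) ^+ 2)%R] <=
   \sum_(1 <= i < n.+1) 'E_P[fun w => ((Z i w - Z i.-1 w) ^+ 2)%R])%E.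
Proof.
rewrite /=; set Z := interpolated f X Y.
have ZE i k : ('E_P[fun w => ((Z i w - Z k w) ^+ 2)%R] =
    sqdist X Y f (fun j => (j < k)%N) (fun j => (j < i)%N))%E.
  by rewrite sqdistC.
under eq_bigr do rewrite ZE.
rewrite ZE; exact: (sqdist_telescope indep exch mf n).
Qed.
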